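(* Let $p$ be an odd prime, $e$ a positive integer, $q=p^e$ and $Q=q^2$. Let $T\in\mathbb{F}_Q[X,Y,Z]$ be the polynomial $$T(X,Y,Z) = XY-2^{-1}t_{(Q+1)/2}(X)\,t_q(Y) + Z - \sum_{i=0}^{q-2}g_i(X)\,t_q(Y)^{i+1}\,t_q(Z)^{q-(i+1)},$$ where $$g_i(X) = (-4)^{-(i+1)}\sum_{j=0}^{i+1} C[j(q-1)+i]\,X^{j(q-1)+i+1}.$$ Then for all $x,y,z\in\mathbb{F}_Q$, the differential uniformity over $\mathbb{F}_Q$ of each of the polynomials $T(x,Y,z)\in\mathbb{F}_Q[Y]$ and $T(x,y,Z)\in\mathbb{F}_Q[Z]$ is $Q$ (maximal).
   Context: $\mathbb{F}_Q$ is the finite field with $Q$ elements. $t_n(X)=X^n-X$. $C[n]=\frac{1}{n+1}\binom{2n}{n}$ is the $n$-th Catalan number; integers (and inverses of integers prime to $p$) are read in $\mathbb{F}_p\subset\mathbb{F}_Q$ when used as coefficients. For a univariate polynomial $f$ over $\mathbb{F}_Q$, the uniformity of $f$ is $u(f)=\max_{b\in\mathbb{F}_Q}\#\{a\in\mathbb{F}_Q : f(a)=b\}$. For $a\in\mathbb{F}_Q\setminus\{0\}$, $\Delta_{f,a}(x)=f(x+a)-f(x)$. The differential uniformity of $f$ over $\mathbb{F}_Q$ is $\delta_f=\max_{a\in\mathbb{F}_Q\setminus\{0\}}u(\Delta_{f,a})$. *)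

(* Defs.v *)
From HB Require Import structures.
From mathcomp Require Import all_boot all_order all_algebra all_field.
From mathcomp Require Import mpoly.

Set Implicit Arguments.
Unset Strict Implicit.
Unset Printing Implicit Defensive.

Import GRing.Theory.
Local Open Scope ring_scope.

Section Uniformity.
Variable F : finFieldType.
Implicit Types (f : {poly F}) (a b : F).

Definition uniformity f : nat := \max_(b : F) #|[set a : F | f.[a] == b]|.

Definition difference f a : {poly F} := f \Po ('X + a%:P) - f.

Definition differential_uniformity f : nat :=
  \max_(a : F | a != 0) uniformity (difference f a).

End Uniformity.

(* The division is exact, see [catalan_mul]. *)
Definition catalan (n : nat) : nat := ('C(n.*2, n) %/ n.+1)%N.

Lemma catalan_mul (n : nat) : (n.+1 * catalan n)%N = 'C(n.*2, n).
Proof.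
rewrite /catalan mulnC divnK //.
have h : (n.+1 * 'C(n.*2, n.+1))%N = (n * 'C(n.*2, n))%N.
  by rewrite mul_bin_left -addnn addnK.
have e : (n.+1 * ('C(n.*2, n) - 'C(n.*2, n.+1)))%N = 'C(n.*2, n).
  by rewrite mulnBr h mulSn addnK.
by rewrite -[X in (_ %| X)%N]e dvdn_mulr.
Qed.

Section PolynomialT.
Variables (F : fieldType) (q : nat).

Definition t (n : nat) : {poly F} := 'X^n - 'X.

Definition g (i : nat) : {poly F} :=
  (- 4) ^- i.+1 *:
    \sum_(0 <= j < i.+2)
      (catalan (j * (q - 1) + i))%:R *: 'X^(j * (q - 1) + i + 1).

Let X : {mpoly F[3]} := 'X_0.
Let Y : {mpoly F[3]} := 'X_1.
Let Z : {mpoly F[3]} := 'X_2.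

(* [horner_alg A f] is the substitution f(A). *)
Definition T : {mpoly F[3]} :=
  X * Y - 2^-1 *: (horner_alg X (t ((q ^ 2 + 1) %/ 2)) * horner_alg Y (t q))
  + Z
  - \sum_(0 <= i < q - 1)
      horner_alg X (g i) * horner_alg Y (t q) ^+ (i + 1)
      * horner_alg Z (t q) ^+ (q - (i + 1)).

End PolynomialT.

(* Substitution of univariate polynomials for the three variables; with two
   constants and one 'X it is the partial evaluation landing in F[X]. *)
Definition subst3 (F : fieldType) (P : {mpoly F[3]}) (a b c : {poly F}) :
    {poly F} :=
  mmap (@polyC F) (tnth [tuple a; b; c]) P.

(* Main.v *)
(* Each of the two polynomials is an affine polynomial plus a polynomial in
   t_q of its variable.  As q is a power of the characteristic, t_q is invariant
   under translation by 1, so the difference in direction 1 is a constant,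
   which takes a single value on all of F. *)
Require Import Defs.
From HB Require Import structures.
From mathcomp Require Import all_boot all_order all_algebra all_field.
From mathcomp Require Import mpoly ring.

Import GRing.Theory.
Local Open Scope ring_scope.

Section Uniformity.
Variable F : finFieldType.
Implicit Type f : {poly F}.

Lemma uniformity_le_card f : (uniformity f <= #|F|)%N.
Proof. by apply/bigmax_leqP => b _; apply: max_card. Qed.

Lemma uniformityC (c : F) : uniformity c%:P = #|F|.
Proof.
apply/eqP; rewrite eqn_leq uniformity_le_card /=.
apply: leq_trans (leq_bigmax c); rewrite -cardsT.
by apply/subset_leq_card/subsetP => a _; rewrite inE hornerC.
Qed.

(** A constant difference in one nonzero direction has the whole field as a fibre, and no fibre can
    be larger. *)
Lemma differential_uniformity_max f (a c : F) :
  a != 0 -> difference f a = c%:P -> differential_uniformity f = #|F|.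
Proof.
move=> a0 fE; apply/eqP; rewrite eqn_leq; apply/andP; split.
  by apply/bigmax_leqP => b _; apply: uniformity_le_card.
by rewrite -(uniformityC c) -fE; apply: leq_bigmax_cond.
Qed.

End Uniformity.

Section Substitution.
Variable F : fieldType.
Implicit Types (a b c r : {poly F}) (q : nat).

(** Carries a substitution past the univariate factors of [T], turning them into compositions;
    induction along the Horner form of [f]. *)
Lemma mmap_horner_alg n (h : 'I_n -> {poly F}) (A : {mpoly F[n]}) (f : {poly F}) :
  mmap (@polyC F) h (horner_alg A f) = f \Po mmap (@polyC F) h A.
Proof.
elim/poly_ind: f => [|f c IHf]; first by rewrite !(rmorph0, comp_poly0).
rewrite comp_poly_MXaddC !(rmorphD, rmorphM) /= IHf.
by rewrite horner_algX horner_algC mmapZ rmorph1 mulr1.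
Qed.

Lemma subst3_T q a b c :
  subst3 (T F q) a b c =
    a * b - 2^-1 *: ((t F ((q ^ 2 + 1) %/ 2) \Po a) * (t F q \Po b)) + c
    - \sum_(0 <= i < q - 1)
        (g F q i \Po a) * (t F q \Po b) ^+ (i + 1)
        * (t F q \Po c) ^+ (q - (i + 1)).
Proof.
(* Generalizing [t] and [g] makes the morphism rules stop at these factors. *)
rewrite /subst3 /T; move: (t F _) (t F q) (g F q) => t1 t2 gg.
rewrite !(rmorphD, rmorphN, rmorphM, rmorph_sum) /=.
rewrite mmapZ mul_polyC rmorphM /= !mmap_horner_alg !mmapX !mmap1U.
rewrite !(tnth_nth 0) /=; congr (_ - _); apply: eq_bigr => i _.
by rewrite !(rmorphM, rmorphXn) /= !mmap_horner_alg !mmapX !mmap1U !(tnth_nth 0).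
Qed.

(** Shifting the variable thus amounts to shifting the three arguments, of which the constant ones
    stay fixed. *)
Lemma subst3_T_comp q a b c r :
  subst3 (T F q) a b c \Po r = subst3 (T F q) (a \Po r) (b \Po r) (c \Po r).
Proof.
rewrite !subst3_T; move: (t F _) (t F q) (g F q) => t1 t2 gg.
rewrite !(rmorphD, rmorphN, rmorphM, rmorph_sum) /=.
rewrite comp_polyZ rmorphM /= -!comp_polyA; congr (_ - _); apply: eq_bigr => i _.
by rewrite !(rmorphM, rmorphXn) /= -!comp_polyA.
Qed.

(** By additivity of Frobenius, [('X + 1) ^+ q] is ['X^q + 1], and the two ones cancel. *)
Lemma t_pchar_translate q (pchar_q : [pchar F].-nat q) :
  t F q \Po ('X + 1) = t F q.
Proof.
rewrite /t comp_polyB comp_Xn_poly comp_polyX exprDn_pchar.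
  by rewrite expr1n opprD addrACA subrr addr0.
by rewrite (eq_pnat _ (pchar_poly F)).
Qed.

End Substitution.

Theorem corollary20 (p e : nat) (p_prime : prime p) (p_odd : odd p)
    (e_gt0 : (0 < e)%N) (q Q : nat) (q_def : q = (p ^ e)%N)
    (Q_def : Q = (q ^ 2)%N) (F : finFieldType) (card_F : #|F| = Q)
    (x y z : F) :
  differential_uniformity (subst3 (T F q) x%:P 'X z%:P) = Q /\
  differential_uniformity (subst3 (T F q) x%:P y%:P 'X) = Q.
Proof.
have pcharF : p \in [pchar F].
  by apply: (@card_finPcharP F p (e * 2)) => //; rewrite card_F Q_def q_def expnM.
have pchar_q : [pchar F].-nat q.
  by rewrite (eq_pnat _ (pcharf_eq pcharF)) q_def pnatX pnat_id.
have t1 := t_pchar_translate _ _ pchar_q.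
rewrite -card_F; split.
(* Outside [t F q], the variable occurs only in the term [X * Y], whose increment is [x]. *)
- apply: (@differential_uniformity_max _ _ 1 x); first exact: oner_neq0.
  rewrite /difference subst3_T_comp !comp_polyC comp_polyX !subst3_T t1 comp_polyXr.
  by ring.
(* Here the only such term is [Z] itself, with increment 1. *)
- apply: (@differential_uniformity_max _ _ 1 1); first exact: oner_neq0.
  rewrite /difference subst3_T_comp !comp_polyC comp_polyX !subst3_T t1 comp_polyXr.
  by ring.
Qed.
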